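(* Let $R$ be a Noetherian ring, $M$ a finitely generated $R$-module, and $\mathcal{F}$ a pretty clean filtration of $M$. Then $\operatorname{Supp}(\mathcal{F})=\operatorname{Ass}(M)$.
   Context: A prime filtration of $M$ is a filtration $\mathcal{F}:0=M_0\subset M_1\subset\cdots\subset M_r=M$ by submodules with $M_i/M_{i-1}\cong R/P_i$, $P_i$ a prime ideal, for $i=1,\dots,r$; set $\operatorname{Supp}(\mathcal{F})=\{P_1,\dots,P_r\}$. It is pretty clean if for all $i<j$ with $P_i\subset P_j$ one has $P_i=P_j$. *)

(* Defs.v *)
From HB Require Import structures.
From mathcomp Require Import all_boot all_algebra.
From mathcomp Require Import boolp classical_sets.
Set Implicit Arguments.
Unset Strict Implicit.
Unset Printing Implicit Defensive.

Import GRing.Theory.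
Local Open Scope ring_scope.
Local Open Scope quotient_scope.

(* Submodules of M are the boolean predicates [submodClosed M] of the MathComp
   hierarchy, and ideals of R are submodules of the regular module R^o.  Under
   the axioms of boolp every Prop-valued subset is such a predicate, so nothing
   is lost.  R ranges over comPzRingType in order to allow the zero ring; for
   this reason [prime_idealr], which needs R nonzero, is not used. *)

Section Submodule.
Variables (R : pzRingType) (M : lmodType R) (N : submodClosed M).

Record submod := Submod { submod_val : M; _ : submod_val \in N }.

HB.instance Definition _ := [isSub for submod_val].
HB.instance Definition _ := [Choice of submod by <:].
HB.instance Definition _ := [SubChoice_isSubLmodule of submod by <:].

End Submodule.

(* M / N, as the library's quotient of additive groups together with the
   induced scaling. *)
Section QuotientModule.
Variables (R : pzRingType) (M : lmodType R) (N : submodClosed M).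

(* A copy of N declared as zmodClosed: [submodClosed] does not inherit from
   [zmodClosed], which [Quotient.quot] expects. *)
Definition submod_zmod : {pred M} := fun x => x \in N.

Fact submod_zmod_closed : zmod_closed submod_zmod.
Proof. exact: GRing.submod_closedB (GRing.submodClosedP N). Qed.

HB.instance Definition _ := GRing.isZmodClosed.Build M submod_zmod
  submod_zmod_closed.

Definition quotmod : Type := Quotient.quot submod_zmod.

HB.instance Definition _ := GRing.Zmodule.on quotmod.
HB.instance Definition _ := EqQuotient.on quotmod.

Definition quotmod_scale (a : R) (x : quotmod) : quotmod :=
  \pi_quotmod (a *: repr x).

Fact eq_quotmod (x y : M) :
  (\pi_quotmod x == \pi_quotmod y) = (x - y \in N).
Proof. exact: esym (Quotient.idealrBE submod_zmod x y). Qed.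

Fact pi_quotmodD (x y : M) :
  \pi_quotmod (x + y) = \pi_quotmod x + \pi_quotmod y.
Proof. exact: (@Quotient.pi_add _ submod_zmod). Qed.

Fact pi_quotmodZ a (x : M) :
  \pi_quotmod (a *: x) = quotmod_scale a (\pi_quotmod x).
Proof.
apply/eqP; rewrite eq_quotmod -scalerBr; apply: rpredZ.
by rewrite -eq_quotmod reprK eqxx.
Qed.

Fact quotmod_scalerA a b x :
  quotmod_scale a (quotmod_scale b x) = quotmod_scale (a * b) x.
Proof.
rewrite -[x]reprK -(pi_quotmodZ b) -(pi_quotmodZ a) -(pi_quotmodZ (a * b)).
by rewrite scalerA.
Qed.

Fact quotmod_scale1r : left_id 1 quotmod_scale.
Proof. by move=> x; rewrite -[x]reprK -pi_quotmodZ scale1r. Qed.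

Fact quotmod_scalerDr : right_distributive quotmod_scale +%R.
Proof.
move=> a x y; rewrite -[x]reprK -[y]reprK.
by rewrite -pi_quotmodD -!pi_quotmodZ -pi_quotmodD scalerDr.
Qed.

Fact quotmod_scalerDl x : {morph quotmod_scale^~ x : a b / a + b}.
Proof.
by move=> a b; rewrite -[x]reprK -!pi_quotmodZ -pi_quotmodD scalerDl.
Qed.

HB.instance Definition _ := GRing.Zmodule_isLmodule.Build R quotmod
  quotmod_scalerA quotmod_scale1r quotmod_scalerDr quotmod_scalerDl.

End QuotientModule.

(* N / L for L a submodule of N: the quotient of the module N by L, where L is
   first pulled back along the inclusion of N in M. *)
Section Subquotient.
Variables (R : pzRingType) (M : lmodType R) (N L : submodClosed M).

Definition submod_pull : {pred submod N} := fun x => val x \in L.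

Fact submod_pull_closed : submod_closed submod_pull.
Proof.
split=> [|a x y xL yL]; rewrite unfold_in; first by rewrite raddf0 rpred0.
by rewrite linearP; apply: rpredD => //; apply: rpredZ.
Qed.

HB.instance Definition _ := GRing.isSubmodClosed.Build R (submod N) submod_pull
  submod_pull_closed.

Definition subquot : Type := quotmod submod_pull.

HB.instance Definition _ := GRing.Lmodule.on subquot.

End Subquotient.

Definition isomorphic (R : pzRingType) (M N : lmodType R) : Prop :=
  exists f : {linear M -> N}, bijective f.

Definition finitely_generated (R : pzRingType) (M : lmodType R)
    (N : {pred M}) : Prop :=
  exists (n : nat) (g : 'I_n -> M),
    forall x, x \in N <-> exists c : 'I_n -> R, x = \sum_i c i *: g i.

Definition noetherian (R : comPzRingType) : Prop :=
  forall I : submodClosed R^o, finitely_generated I.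

Definition prime_ideal (R : comPzRingType) (P : {pred R}) : Prop :=
  [/\ submod_closed (P : {pred R^o}), 1 \notin P
    & forall a b, a * b \in P -> a \in P \/ b \in P].

Definition annihilator (R : comPzRingType) (M : lmodType R) (m : M) :
  {pred R} := fun a => a *: m == 0.

Definition Ass (R : comPzRingType) (M : lmodType R) : set {pred R} :=
  [set P : {pred R} | prime_ideal P /\ exists m : M, P = annihilator m].

(* 0 = M_0 c M_1 c ... c M_r = M with M_(i+1) / M_i isomorphic to R / P_i for
   i < r: the primes are numbered from 0. *)
Record prime_filtration (R : comPzRingType) (M : lmodType R) :=
    PrimeFiltration {
  pf_len : nat;
  pf_mod : 'I_pf_len.+1 -> submodClosed M;
  pf_prime : 'I_pf_len -> submodClosed R^o;
  pf_mod0 : forall x, (x \in pf_mod ord0) = (x == 0);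
  pf_modT : forall x, x \in pf_mod ord_max;
  pf_modS : forall i : 'I_pf_len,
    {subset pf_mod (widen_ord (leqnSn _) i) <= pf_mod (lift ord0 i)};
  pf_primeP : forall i, prime_ideal (pf_prime i);
  pf_iso : forall i : 'I_pf_len,
    isomorphic (subquot (pf_mod (lift ord0 i))
                        (pf_mod (widen_ord (leqnSn _) i)))
               (quotmod (pf_prime i))
}.

Arguments pf_mod {R M} F i : rename.
Arguments pf_prime {R M} F i : rename.
Arguments pf_mod0 {R M} F x : rename.
Arguments pf_modT {R M} F x : rename.
Arguments pf_modS {R M} F i : rename.
Arguments pf_primeP {R M} F i : rename.
Arguments pf_iso {R M} F i : rename.

Definition Supp (R : comPzRingType) (M : lmodType R)
    (F : prime_filtration M) : set {pred R} :=
  [set P : {pred R} | exists i, P = pf_prime F i].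

Definition pretty_clean (R : comPzRingType) (M : lmodType R)
    (F : prime_filtration M) : Prop :=
  forall i j : 'I_(pf_len F), (i < j)%N ->
    {subset pf_prime F i <= pf_prime F j} -> pf_prime F i =i pf_prime F j.

(* Main.v *)
Require Import Defs.
From mathcomp Require Import all_boot all_algebra.
From mathcomp Require Import boolp classical_sets.

Set Implicit Arguments.
Unset Strict Implicit.
Unset Printing Implicit Defensive.

Import GRing.Theory.
Local Open Scope ring_scope.
Local Open Scope quotient_scope.

(* Each quotient M_(i+1) / M_i is generated by the class of some x whose
   annihilator modulo M_i is P_i, and since P_i is prime, so is the annihilator
   modulo M_i of every y in M_(i+1) outside M_i.

   Ass(M) is contained in Supp(F): if P = ann(m), let k be minimal such that
   M_k contains a nonzero multiple y of m.  Then ann(y) = P, and it is also the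
   annihilator of y modulo M_(k-1), because R y meets M_(k-1) trivially.

   Supp(F) is contained in Ass(M): let i be minimal with P_i = P.  Pretty
   cleanness gives a_j in P_j outside P for all j < i, and the product s of the
   a_j kills M_i, so that ann(s x) = P for x generating M_(i+1) modulo M_i. *)

Lemma subquot_generator (R : comPzRingType) (M : lmodType R)
    (N L : submodClosed M) (P : submodClosed R^o) :
  isomorphic (subquot N L) (quotmod P) ->
  exists2 x, x \in N & (forall a, (a *: x \in L) = (a \in P)) /\
    forall y, y \in N -> exists a, y - a *: x \in L.
Proof.
move=> [f [g fK gK]].
(* The generator lifts the element of the quotient that corresponds to the class of 1 in [R / P]. *)
pose x : submod N := repr (g (\pi_(quotmod P) (1 : R^o))).
have fx a : f (\pi_(subquot N L) (a *: x)) = \pi_(quotmod P) (a : R^o).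
  have -> : \pi_(subquot N L) (a *: x)
      = a *: (\pi_(subquot N L) x : subquot N L).
    exact: pi_quotmodZ.
  rewrite linearZ /= [\pi x]reprK gK.
  rewrite -[RHS](congr1 (fun b : R => \pi_(quotmod P) (b : R^o)) (mulr1 a)).
  exact: esym (pi_quotmodZ _ _ _).
exists (val x); first exact: (valP x).
split=> [a|y yN].
  have -> : (a *: val x \in L) = (a *: x - 0 \in submod_pull (N := N) L).
    by rewrite subr0 [RHS]unfold_in linearZ.
  rewrite -eq_quotmod -(inj_eq (can_inj fK)) -(scale0r x) !fx.
  by rewrite eq_quotmod subr0.
pose y' : submod N := Submod yN.
(* The coefficient of [y] is any lift to [R] of the image of its class under [f]. *)
exists (repr (f (\pi_(subquot N L) y'))).
set a := repr _.
have : y' - a *: x \in submod_pull (N := N) L.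
  rewrite -eq_quotmod -(inj_eq (can_inj fK)) fx.
  by rewrite /a reprK.
by rewrite unfold_in linearB linearZ.
Qed.

Section PrimeFiltration.
Variables (R : comPzRingType) (M : lmodType R) (F : prime_filtration M).

(* M_k for an arbitrary natural number k; the junk value for k > r is M_0. *)
Let Mn (k : nat) : submodClosed M := pf_mod F (inord k).

Let Mn_lift (i : 'I_(pf_len F)) : pf_mod F (lift ord0 i) = Mn i.+1.
Proof.
by congr (pf_mod F _); apply: val_inj; rewrite /= inordK // ltnS.
Qed.

Let Mn_widen (i : 'I_(pf_len F)) :
  pf_mod F (widen_ord (leqnSn _) i) = Mn i.
Proof.
by congr (pf_mod F _); apply: val_inj; rewrite /= inordK // ltnS ltnW.
Qed.

Let Mn0 x : (x \in Mn 0) = (x == 0).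
Proof.
rewrite -(pf_mod0 F); congr (x \in pf_mod F _).
by apply: val_inj; rewrite /= inordK.
Qed.

Let MnT x : x \in Mn (pf_len F).
Proof.
suff -> : Mn (pf_len F) = pf_mod F ord_max by apply: pf_modT.
by congr (pf_mod F _); apply: val_inj; rewrite /= inordK.
Qed.

Lemma prime_filtration_generator (i : 'I_(pf_len F)) :
  exists2 x, x \in Mn i.+1 &
    (forall a, (a *: x \in Mn i) = (a \in pf_prime F i)) /\
    forall y, y \in Mn i.+1 -> exists a, y - a *: x \in Mn i.
Proof.
by have /subquot_generator := pf_iso F i; rewrite Mn_lift Mn_widen.
Qed.

Lemma prime_filtration_scale_in (i : 'I_(pf_len F)) a y :
  a \in pf_prime F i -> y \in Mn i.+1 -> a *: y \in Mn i.
Proof.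
have [x _ [xP xgen]] := prime_filtration_generator i.
move=> aP /xgen[b yb]; rewrite -[y](subrK (b *: x)) scalerDr.
apply: rpredD; first exact: rpredZ.
by rewrite scalerA mulrC -scalerA rpredZ // xP.
Qed.

(** Modulo M_i, [y] is [b *: x] for the generator [x], and [b] lies outside P_i because [y] lies
    outside M_i. Hence [a *: y] in M_i puts [a * b], and so [a], in P_i. *)
Lemma prime_filtration_ann_mod (i : 'I_(pf_len F)) a y :
  y \in Mn i.+1 -> y \notin Mn i -> (a *: y \in Mn i) = (a \in pf_prime F i).
Proof.
move=> yS yN; apply/idP/idP; last by move/prime_filtration_scale_in; apply.
have [x _ [xP /(_ y yS)[b yb]]] := prime_filtration_generator i.
move=> ay.
have : (a * b) *: x \in Mn i.
  have -> : (a * b) *: x = a *: y + (- a) *: (y - b *: x).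
    by rewrite scaleNr scalerBr opprB addrC subrK scalerA.
  by apply: rpredD => //; apply: rpredZ.
have [_ _ Pprime] := pf_primeP F i.
rewrite xP => /Pprime[//|bP]; case/negP: yN.
by rewrite -[y](subrK (b *: x)); apply: rpredD; rewrite // xP.
Qed.

Lemma Ass_sub_Supp : (Ass M `<=` Supp F)%classic.
Proof.
move=> P [[_ P1 Pprime] [m Pm]].
have inP a : (a \in P) = (a *: m == 0) by rewrite Pm.
have annP a b : b *: m != 0 -> (a *: (b *: m) == 0) = (a \in P).
  rewrite scalerA -!inP => bP; apply/idP/idP => [/Pprime[//|bP']|].
    by rewrite bP' in bP.
  by rewrite !inP mulrC -scalerA => /eqP->; rewrite scaler0.
pose meets k := `[< exists b, b *: m != 0 /\ b *: m \in Mn k >].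
have exk : exists k, meets k.
  exists (pf_len F); apply/asboolP; exists 1; split; last exact: MnT.
  by rewrite -inP.
case: (ex_minnP exk) => k /asboolP[b [b0 bk]] kmin.
(* M_0 = 0 contains no nonzero multiple, so the minimal index is a successor, henceforth [k.+1]. *)
case: k => [|k] in bk kmin *; first by rewrite Mn0 (negPf b0) in bk.
have avoid c : c *: m \in Mn k -> c *: m = 0.
  move=> ck; apply/eqP/negPn/negP => c0.
  suff /kmin : meets k by rewrite ltnn.
  by apply/asboolP; exists c.
(* M_r = M already meets the nonzero multiples of [m], so minimality keeps [k.+1] within the true
   range of indices. *)
have kr : (k < pf_len F)%N.
  by apply: kmin; apply/asboolP; exists b; split.
pose i := Ordinal kr; exists i.
apply/funext => a; rewrite -[LHS]/(a \in P) -[RHS]/(a \in pf_prime F i).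
have bN : b *: m \notin Mn k by apply: contra b0 => /avoid/eqP.
rewrite -(annP a b b0) -(prime_filtration_ann_mod (i := i) a bk bN).
by apply/eqP/idP => [->|]; [exact: rpred0 | rewrite scalerA => /avoid].
Qed.

Lemma prime_filtration_avoid_kill (P : {pred R}) k :
  prime_ideal P -> (k <= pf_len F)%N ->
  (forall j : 'I_(pf_len F), (j < k)%N -> ~ {subset pf_prime F j <= P}) ->
  exists2 s, s \notin P & forall y, y \in Mn k -> s *: y = 0.
Proof.
move=> [_ P1 Pprime]; elim: k => [|k IHk] kr avoid.
  by exists 1 => // y; rewrite Mn0 => /eqP->; rewrite scaler0.
have [s sP skill] := IHk (ltnW kr) (fun j jk => avoid j (ltnW jk)).
have /existsNP[a /not_implyP[ak /negP aP]] := avoid (Ordinal kr) (ltnSn k).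
(* [a] sends M_(k+1) into M_k, which [s] kills. *)
exists (s * a) => [|y yk]; first by apply/negP => /Pprime[]; apply/negP.
by rewrite -scalerA skill // (prime_filtration_scale_in (i := Ordinal kr)).
Qed.

Lemma pretty_clean_Supp_sub_Ass :
  pretty_clean F -> (Supp F `<=` Ass M)%classic.
Proof.
move=> Fclean _ [i0 ->]; split; first exact: pf_primeP.
set P : {pred R} := pf_prime F i0.
have PP : `[< pf_prime F i0 =i P >] by apply/asboolP.
have [i /asboolP iP imin] := arg_minnP (P := fun i => `[< pf_prime F i =i P >])
  (@nat_of_ord _) PP.
have [s sP skill] : exists2 s, s \notin P & forall y, y \in Mn i -> s *: y = 0.
  apply: prime_filtration_avoid_kill; [exact: pf_primeP | exact: ltnW |].
  move=> j ji jP.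
  (* An earlier prime inside P would equal P by pretty cleanness, against the minimality of [i]. *)
  have jiE : pf_prime F j =i pf_prime F i.
    by apply: Fclean => // a /jP; rewrite iP.
  suff /imin : `[< pf_prime F j =i P >] by rewrite leqNgt ji.
  by apply/asboolP => a; rewrite jiE iP.
have [x _ [xP _]] := prime_filtration_generator i.
have [_ _ Pprime] := pf_primeP F i0.
exists (s *: x); apply/funext => a.
rewrite -[LHS]/(a \in P) /annihilator scalerA.
apply/idP/eqP => [aP|asx].
  by rewrite mulrC -scalerA skill // xP iP.
(* As 0 lies in M_i, [a * s] annihilates [x] modulo M_i; primality then removes [s]. *)
have : a * s \in P by rewrite -iP -xP asx rpred0.
by move=> /Pprime[//|sP']; rewrite sP' in sP.
Qed.

End PrimeFiltration.

Theorem corollary3p6 (R : comPzRingType) (M : lmodType R)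
    (F : prime_filtration M) :
  noetherian R -> finitely_generated (predT : {pred M}) -> pretty_clean F ->
  Supp F = Ass M.
Proof.
move=> _ _ Fclean; apply/seteqP; split.
  exact: pretty_clean_Supp_sub_Ass.
exact: Ass_sub_Supp.
Qed.
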